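(* Let $(S_t)_{t\ge0}$ be the Gamma process and let $R=S^{-1}$ be its right-continuous inverse process, $R_t=\inf\{u\ge0:S_u>t\}$. Then: 1. Almost all paths of $R_t$ are continuous. 2. $\mathbb{E}\,R_t^{\theta R_t}<\infty$ for every $\theta<1$ and $t>0$; so, the exponential moments $\mathbb{E}\,e^{\theta R_t}$ exist (are finite, for every real $\theta$ and $t>0$). 3. For $t>0$, $\mathbb{E}\,R_t^{R_t}<\infty$ if and only if $t<\frac1e$.
   Context: The Gamma process $(S_t)_{t\ge0}$ is the Lévy process with $S_0=0$, right-continuous paths with left limits, independent and stationary increments, and $S_t$ having the Gamma density $\frac{x^{t-1}}{\Gamma(t)}e^{-x}$, $x>0$, for $t>0$. The convention $0^0:=1$ is used. *)

(* Defs.v *)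
From HB Require Import structures.
From mathcomp Require Import all_boot all_order all_algebra.
From mathcomp Require Import all_classical all_reals all_analysis.
Set Implicit Arguments.
Unset Strict Implicit.
Unset Printing Implicit Defensive.
Import Order.TTheory GRing.Theory Num.Theory.
Import numFieldNormedType.Exports.
Local Open Scope classical_set_scope.
Local Open Scope ring_scope.

Definition Gamma_fun (R : realType) (t : R) : R :=
  \int[lebesgue_measure]_(x in `]0, +oo[) (x `^ (t - 1) * expR (- x)).

Definition gamma_pdf (R : realType) (t x : R) : R :=
  if 0 < x then x `^ (t - 1) / Gamma_fun t * expR (- x) else 0.

Section processes.
Context {d : measure_display} {T : measurableType d} {R : realType} (P : probability T R).

Definition has_density (X : {RV P >-> R}) (f : R -> R) : Prop :=
  forall B : set R, measurable B ->
    distribution P X B = (\int[lebesgue_measure]_(x in B) (f x)%:E)%E.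

(* For a finite family, the product rule over all subfamilies reduces to the
   one over the whole family, by taking [B i = setT] for the other indices. *)
Definition mutually_independent (n : nat) (X : 'I_n -> T -> R) : Prop :=
  forall B : 'I_n -> set R, (forall i, measurable (B i)) ->
    P (\bigcap_(i in [set: 'I_n]) (X i @^-1` B i)) =
    (\prod_(i < n) P (X i @^-1` B i))%E.

(* A process indexed by [0, +oo[ is a function on R; its values at negative
   times are irrelevant: none of the definitions below refers to them. *)

Definition cadlag_paths (S : R -> {RV P >-> R}) : Prop :=
  forall w : T,
    (forall t : R, 0 <= t -> S u w @[u --> t^'+] --> S t w) /\
    (forall t : R, 0 < t -> cvg (S u w @[u --> t^'-])).

Definition independent_increments (S : R -> {RV P >-> R}) : Prop :=
  forall (n : nat) (t : nat -> R), 0 <= t 0%N -> nondecreasing_seq t ->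
    mutually_independent (fun i : 'I_n => S (t i.+1) \- S (t i)).

Definition stationary_increments (S : R -> {RV P >-> R}) : Prop :=
  forall s t h : R, 0 <= s -> 0 <= t -> 0 <= h ->
    forall B : set R, measurable B ->
      P ((S (s + h) \- S s) @^-1` B) =
      P ((S (t + h) \- S t) @^-1` B).

Definition gamma_process (S : R -> {RV P >-> R}) : Prop :=
  [/\ forall w : T, S 0 w = 0,
      cadlag_paths S,
      independent_increments S,
      stationary_increments S &
      forall t : R, 0 < t -> has_density (S t) (gamma_pdf t)].

(* Extended-real valued: the infimum of the empty set is +oo. *)
Definition right_continuous_inverse (S : R -> {RV P >-> R}) (t : R) (w : T) : \bar R :=
  ereal_inf [set u%:E | u in [set u : R | 0 <= u /\ t < S u w]].

End processes.

(* Main.v *)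
Require Import Defs.
From HB Require Import structures.
From mathcomp Require Import all_boot all_order all_algebra.
From mathcomp Require Import all_classical all_reals all_analysis.
From mathcomp Require Import measurable_realfun ring lra.
Import Order.TTheory GRing.Theory Num.Theory.
Import numFieldNormedType.Exports.
Local Open Scope classical_set_scope.
Local Open Scope ring_scope.

Set Implicit Arguments.
Unset Strict Implicit.
Unset Printing Implicit Defensive.

(** Every path of the Gamma process has an inverse that is finite and continuous
as soon as the path is strictly increasing and unbounded, and almost all paths
are. Indeed an increment over a time interval of positive length has a density
carried by the positive half-line, so it is positive almost surely; applying
this to the countably many pairs of rational times and using right-continuity
gives strict monotonicity ([increasing_from_rat], [gamma_process_increasing]).

The moments rest on the fact that [R_t] is larger than an integer [n] exactly
when [S_n] has not yet passed [t], up to boundary cases, and that at integer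
times the distribution function of [S_n] is elementary:
  [exp (- t) * t ^ n / n! <= P (S_n <= t) <= t ^ n / n!],
because the density is [x ^ (n - 1) / (n - 1)! * exp (- x)] and the exponential
lies between [exp (- t)] and [1] on the interval from [0] to [t]
([gamma_process_le], [gamma_process_ge]). So [R_t] has the tails of a Poisson
variable, and [n ^ n * P (S_n <= t)] is of the order of [(e * t) ^ n] up to a
power of [n]: the threshold [1 / e] is where this geometric ratio crosses [1].

- Below the threshold, on the event that [R_t] is between [k + 1] and [k + 2] one
  has [S_k <= t], which bounds the moment by the series of
  [(k + 2) ^ (k + 2) * t ^ k / k!] ([expectation_inverse_lty]). The shift by two costs
  only a factor [(k + 2) ^ 2], since [(k + 2) ^ k / k!] is at most [exp (k + 2)].
  The same lemma covers functions that are smaller than [x ^ x] by an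
  exponential factor [K ^ (- x)], the gain being that [t] is replaced by [t / K].
  Both [x ^ (theta * x)] with [theta < 1] and [exp (theta * x)] are smaller than [x ^ x] by
  every such factor ([powR_le_self_powR]), so for them [t] can be as large as
  one wants.
- At the threshold and above it, the sum of [n ^ n / 2] over the integers
  [1 <= n <= x] is at most [x ^ x], so the moment is at least the sum of the
  [n ^ n / 2 * P (S_n <= t)]; by [n! * e ^ n <= e * n ^ (n + 1)] its general term
  is at least a constant times [1 / n], and the harmonic series diverges
  ([expectation_inverse_self_powR_ge]). *)

(** * Generalized inverse of a right-continuous function *)

(** One path of the inverse process: [right_continuous_inverse S t w] is by
conversion [gen_inv (S ^~ w) t]. *)
Definition gen_inv (R : realType) (f : R -> R) (t : R) : \bar R :=
  ereal_inf [set u%:E | u in [set u : R | 0 <= u /\ t < f u]].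

Lemma gen_inv_ge0 (R : realType) (f : R -> R) (t : R) : (0 <= gen_inv f t)%E.
Proof. by apply: le_ereal_inf_tmp => _ [u [u0 _] <-]; rewrite lee_fin. Qed.

Lemma gen_inv_le (R : realType) (f : R -> R) (t a : R) :
  0 <= a -> t < f a -> (gen_inv f t <= a%:E)%E.
Proof. by move=> a0 ta; apply: ereal_inf_lbound; exists a. Qed.

Lemma gen_inv_gt (R : realType) (f : R -> R) (t a : R) :
  0 <= a -> (a%:E < gen_inv f t)%E -> f a <= t.
Proof.
move=> a0 lt; rewrite leNgt; apply/negP => /(gen_inv_le a0).
by rewrite leNgt lt.
Qed.

Lemma gen_inv_ge (R : realType) (f : R -> R) (t a : R) :
    (forall u v, 0 <= u -> u < v -> f u < f v) ->
  f a <= t -> (a%:E <= gen_inv f t)%E.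
Proof.
move=> fi fat; apply: le_ereal_inf_tmp => _ [u [u0 tu] <-]; rewrite lee_fin leNgt.
by apply/negP => /(fi _ _ u0) /(lt_trans tu); rewrite ltNge fat.
Qed.

Lemma gen_inv_fin_num (R : realType) (f : R -> R) (t a : R) :
  0 <= a -> t < f a -> gen_inv f t \is a fin_num.
Proof.
move=> a0 ta; rewrite ge0_fin_numE ?gen_inv_ge0//.
by apply: le_lt_trans (ltry a); exact: gen_inv_le.
Qed.

(** A strictly increasing function may jump, and its inverse is then constant
along the jump; only a flat piece of the function could make the inverse jump.
Concretely, with [r] the value of the inverse at [t], the open interval from
[f (r - e)] (or minus infinity, if [r < e]) to [f (r + e)] contains [t] and is
mapped within [e] of [r]. *)
Lemma gen_inv_continuous (R : realType) (f : R -> R) :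
    (forall u v, 0 <= u -> u < v -> f u < f v) ->
    (forall t, exists2 a, 0 <= a & t < f a) ->
  {within `[0, +oo[, continuous (fun t => fine (gen_inv f t))}.
Proof.
move=> fi fy; apply: continuous_subspaceT => t.
have fin s : gen_inv f s \is a fin_num.
  by have [a a0 sa] := fy s; exact: gen_inv_fin_num sa.
apply/cvgrPdist_le => e e0; set r := fine (gen_inv f t).
have r0 : 0 <= r by rewrite /r fine_ge0// gen_inv_ge0.
have re : gen_inv f t = r%:E by rewrite /r fineK.
have tlt : t < f (r + e).
  rewrite ltNge; apply/negP => /(gen_inv_ge fi).
  by rewrite re lee_fin gerDl leNgt e0.
have up : \forall s \near t, fine (gen_inv f s) <= r + e.
  near=> s; rewrite -lee_fin fineK//; apply: gen_inv_le; first by rewrite addr_ge0// ltW.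
  by near: s; exact: lt_nbhsl.
have lo : \forall s \near t, r - e <= fine (gen_inv f s).
  have [re0|re0] := ltP (r - e) 0.
    by near=> s; rewrite (le_trans (ltW re0))// fine_ge0// gen_inv_ge0.
  have flt : f (r - e) < t.
    have h : r - e < r - e / 2 by rewrite ltrD2l ltrN2 gtr_pMr// invf_lt1// ltr1n.
    apply: lt_le_trans (fi _ _ re0 h) _; apply: gen_inv_gt.
      exact: le_trans re0 (ltW h).
    by rewrite re lte_fin gtrDl oppr_lt0 divr_gt0.
  near=> s; rewrite -lee_fin fineK//; apply: gen_inv_ge => //.
  by apply: ltW; near: s; exact: lt_nbhsr.
near=> s; rewrite ler_distlC; apply/andP; split; near: s => //.
Unshelve. all: by end_near.
Qed.

Lemma rat_near_right (R : realType) (s b : R) (A : set R) : s < b ->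
  (\forall u \near s^'+, A u) -> exists2 q : rat, s < ratr q < b & A (ratr q).
Proof.
move=> sb [e /= e0 he].
have m : s < Num.min b (s + e) by rewrite lt_min sb ltrDl.
have [p] := rat_in_itvoo m; rewrite in_itv/= lt_min => /andP[sp /andP[pb pe]].
exists p; first by rewrite sp.
by apply: he => //=; rewrite ltr_distlC pe andbT (lt_trans _ sp)// gtrBl.
Qed.

(** Strict monotonicity at all times from countably many almost sure conditions:
two rationals between [s] and [t] keep the inequality strict when passing to the
limit at both ends. *)
Lemma increasing_from_rat (R : realType) (f : R -> R) :
    (forall t, 0 <= t -> f u @[u --> t^'+] --> f t) ->
    (forall p q : rat, 0 <= p -> p < q -> f (ratr p) < f (ratr q)) ->
  forall s t, 0 <= s -> s < t -> f s < f t.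
Proof.
move=> rc fq s t s0 st.
have t0 : 0 <= t by rewrite (le_trans s0)// ltW.
have rat0 (u : R) (p : rat) : 0 <= u -> u < ratr p -> 0 <= p.
  by move=> u0 up; rewrite -(ler0q R) (le_trans u0)// ltW.
have [q] := rat_in_itvoo st; rewrite in_itv/= => /andP[sq qt].
have [p] := rat_in_itvoo sq; rewrite in_itv/= => /andP[sp pq].
have q0 := rat0 _ _ s0 sq; have p0 := rat0 _ _ s0 sp.
have fsp : f s <= f (ratr p).
  rewrite leNgt; apply/negP => lt.
  have /(rat_near_right sp)[r /andP[sr rp]] : \forall u \near s^'+, f (ratr p) < f u.
    by move/cvgr_gt : (rc s s0); apply.
  by apply/negP; rewrite -leNgt ltW// fq ?(rat0 s)// -(ltr_rat R).
have fqt : f (ratr q) <= f t.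
  rewrite leNgt; apply/negP => lt.
  have t1 : t < t + 1 by rewrite ltrDl.
  have /(rat_near_right t1)[r /andP[tr _]] : \forall u \near t^'+, f u < f (ratr q).
    by move/cvgr_lt : (rc t t0); apply.
  by apply/negP; rewrite -leNgt ltW// fq// -(ltr_rat R) (lt_trans qt).
apply: (le_lt_trans fsp); apply: lt_le_trans fqt; apply: fq => //.
by rewrite -(ltr_rat R).
Qed.

(** Right-continuity lets the infimum be tested on countably many times, which is
what makes the inverse process measurable; monotonicity, which holds only almost
surely, is not involved. *)
Lemma gen_inv_lt (R : realType) (f : R -> R) (t a : R) :
    (forall t, 0 <= t -> f u @[u --> t^'+] --> f t) ->
  (gen_inv f t < a%:E)%E <-> exists q : rat, [/\ 0 <= q, ratr q < a & t < f (ratr q)].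
Proof.
move=> rc; split.
  move=> /ereal_inf_lt[_ [u [u0 tu] <-]]; rewrite lte_fin => ua.
  have /(rat_near_right ua)[q /andP[uq qa] tq] : \forall v \near u^'+, t < f v.
    by move/cvgr_gt : (rc u u0); apply.
  by exists q; split=> //; rewrite -(ler0q R) (le_trans u0)// ltW.
move=> [q [q0 qa tq]]; apply: (@le_lt_trans _ _ (ratr q)%:E); last by rewrite lte_fin.
by apply: gen_inv_le => //; rewrite ler0q.
Qed.

(** * Estimates for self-powers and factorials *)

(** Maximize [x * (ln K - a * ln x)]: with [x0 := K ^ (1 / a)] it equals
[a * x * ln (x0 / x)], and the logarithm is at most [x0 / x - 1]. *)
Lemma powR_le_self_powR (R : realType) (a K : R) : 0 < a -> 0 < K ->
  exists2 C, 0 < C & forall x, 0 <= x -> K `^ x <= C * x `^ (a * x).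
Proof.
move=> a0 K0; set x0 := K `^ a^-1; have x00 : 0 < x0 by exact: powR_gt0.
exists (expR (a * x0)); first exact: expR_gt0.
move=> x; rewrite le_eqVlt => /predU1P[<-|xpos].
  by rewrite mulr0 !powRr0 mulr1 -expR0 ler_expR mulr_ge0 ?ltW.
rewrite /powR !gt_eqF// -expRD ler_expR.
have -> : ln K = a * ln x0 by rewrite ln_powR mulrA divff ?mul1r// gt_eqF.
suff h : x * (ln x0 - ln x) <= x0.
  by move: h => /(ler_wpM2l (ltW a0)); lra.
rewrite -ln_div ?posrE//.
have : ln (1 + (x0 / x - 1)) <= x0 / x - 1.
  by apply: le_ln1Dx; rewrite ltrBrDl subrr divr_gt0.
rewrite addrC subrK => /(ler_wpM2l (ltW xpos)) /le_trans; apply.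
by rewrite mulrBr mulrCA divff ?gt_eqF// !mulr1 gerBl ltW.
Qed.

Lemma sum_self_expn (N : nat) : (\sum_(1 <= n < N.+1) n ^ n <= 2 * N ^ N)%N.
Proof.
elim: N => [|[|N] IH]; [by rewrite big_geq|by rewrite big_nat1|].
rewrite big_nat_recr//= mul2n -addnn leq_add2r (leq_trans IH)//.
by rewrite [leqRHS]expnS leq_mul// leq_exp2r.
Qed.

(** A crude half of the Stirling formula; the induction step is
[(1 - 1 / (n + 2)) ^ (n + 2) <= 1 / e]. *)
Lemma fact_expR_le (R : realType) (n : nat) :
  n.+1`!%:R * expR n.+1%:R <= expR 1 * n.+1%:R ^+ n.+2 :> R.
Proof.
elim: n => [|n IH]; first by rewrite mul1r expr1n mulr1.
have h : n.+1%:R ^+ n.+2 * expR 1 <= n.+2%:R ^+ n.+2 :> R.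
  rewrite -ler_pdivlMr ?expR_gt0// -expRN -ler_pdivrMl ?exprn_gt0//.
  have := @expR_ge1Dx R (- n.+2%:R^-1).
  have -> : 1 - n.+2%:R^-1 = n.+2%:R^-1 * n.+1%:R :> R.
    have -> : n.+1%:R = n.+2%:R - 1 :> R by rewrite -(natr1 n.+1) addrK.
    by rewrite mulrBr mulVf// mulr1.
  have h0 : 0 <= n.+2%:R^-1 * n.+1%:R :> R by rewrite mulr_ge0.
  move=> /(lerXn2r n.+2 h0 (expR_ge0 _)).
  by rewrite -expRM_natr mulNr mulVf// exprMn exprVn.
rewrite factS natrM -(natr1 n.+1) expRD natr1.
have -> : n.+2%:R * n.+1`!%:R * (expR n.+1%:R * expR 1) =
    n.+2%:R * (n.+1`!%:R * expR n.+1%:R) * expR 1 :> R by ring.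
apply: le_trans (ler_wpM2r (expR_ge0 _) (ler_wpM2l _ IH)) _ => //.
have -> : n.+2%:R * (expR 1 * n.+1%:R ^+ n.+2) * expR 1 =
    expR 1 * n.+2%:R * (n.+1%:R ^+ n.+2 * expR 1) :> R by ring.
by rewrite [in leRHS]exprS [leRHS]mulrA ler_wpM2l// mulr_ge0// expR_ge0.
Qed.

Lemma exprn_fact_le_expR (R : realType) (x : R) (n : nat) :
  0 <= x -> x ^+ n / n`!%:R <= expR x.
Proof.
move=> x0; case: n => [|n].
  by rewrite expr0 fact0 divr1 -expR0 ler_expR.
by apply: le_trans (expR_ge1Dxn n x0); rewrite lerDr.
Qed.

Lemma le_self_powR (R : realType) (x y : R) : 1 <= x -> x <= y -> x `^ x <= y `^ y.
Proof.
move=> x1 xy; have x0 : 0 <= x by rewrite (le_trans _ x1).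
have y0 : 0 <= y by rewrite (le_trans x0).
apply: (@le_trans _ _ (y `^ x)); first by rewrite ge0_ler_powR.
by rewrite ler_powR// (le_trans x1).
Qed.

(** Half of the exponential decay of [q ^ k] absorbs the square. *)
Lemma sum_sqr_geometric_lty (R : realType) (q : R) : 0 < q -> q < 1 ->
  (\sum_(k <oo) (k.+2%:R ^+ 2 * q ^+ k)%:E < +oo)%E.
Proof.
(* With this [e], [q = exp (- e) ^ 2]. *)
move=> q0 q1; set e := - ln q / 2.
have e0 : 0 < e by rewrite divr_gt0// oppr_gt0 ln_lt0// q0.
set r := expR (- e); have r0 : 0 < r by exact: expR_gt0.
have r1 : `|r| < 1 by rewrite ger0_norm ?ltW// -expR0 ltr_expR oppr_lt0.
have qe : q = expR (- e) * expR (- e).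
  by rewrite -expRD -[LHS](lnK q0); congr expR; rewrite /e; field.
set a := 2 / e ^+ 2 * expR (e * 2).
apply: (@le_lt_trans _ _ (\sum_(k <oo) (geometric a r k)%:E)%E).
  apply: lee_nneseries => k _; first by rewrite lee_fin mulr_ge0// exprn_ge0// ltW.
  rewrite lee_fin /geometric/=.
  have ek0 : 0 <= e * k.+2%:R by rewrite mulr_ge0// ltW.
  have := exprn_fact_le_expR 2 ek0.
  rewrite exprMn ler_pdivrMr// => h.
  have {}h : k.+2%:R ^+ 2 <= 2 / e ^+ 2 * expR (e * k.+2%:R).
    by rewrite mulrAC ler_pdivlMr ?exprn_gt0// mulrC (le_trans h)// mulrC.
  apply: le_trans (ler_wpM2r _ h) _; first by rewrite exprn_ge0// ltW.
  rewrite /a -[leLHS]mulrA -[leRHS]mulrA ler_wpM2l ?divr_ge0 ?exprn_ge0 ?(ltW e0)//.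
  rewrite qe exprMn /r -expRM_natr.
  rewrite mulrA -!expRD ler_expR.
  rewrite -(natr1 k.+1) -(natr1 k); lra.
rewrite (_ : (fun n => _) = EFin \o series (geometric a r)); last first.
  by apply/funext => n /=; rewrite /series/= sumEFin.
rewrite EFin_lim ?ltry//; exact: is_cvg_geometric_series.
Qed.

(** The term [x ^ k / k!] of the exponential series at [x = k + 2] turns the
quotient into [exp (k + 2)], leaving a geometric series of ratio [s * e] times
a square. *)
Lemma sum_self_expn_fact_lty (R : realType) (s : R) : 0 < s -> s * expR 1 < 1 ->
  (\sum_(k <oo) (k.+2%:R ^+ k.+2 * (s ^+ k / k`!%:R))%:E < +oo)%E.
Proof.
move=> s0 s1; have q0 : 0 < s * expR 1 by rewrite mulr_gt0// expR_gt0.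
apply: (@le_lt_trans _ _
    (\sum_(k <oo) ((expR 2)%:E * (k.+2%:R ^+ 2 * (s * expR 1) ^+ k)%:E))%E).
  apply: lee_nneseries => k _.
    by rewrite lee_fin mulr_ge0 ?exprn_ge0// divr_ge0// exprn_ge0// ltW.
  rewrite -EFinM lee_fin.
  have -> : k.+2%:R ^+ k.+2 * (s ^+ k / k`!%:R) =
      k.+2%:R ^+ 2 * s ^+ k * (k.+2%:R ^+ k / k`!%:R) :> R.
    by rewrite -addn2 exprD; ring.
  have -> : expR 2 * (k.+2%:R ^+ 2 * (s * expR 1) ^+ k) =
      k.+2%:R ^+ 2 * s ^+ k * expR k.+2%:R.
    have -> : expR k.+2%:R = expR 2 * expR 1 ^+ k :> R.
      by rewrite -expRM_natr mul1r -expRD -natrD add2n.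
    by rewrite exprMn; ring.
  by rewrite ler_wpM2l ?exprn_fact_le_expR// mulr_ge0// exprn_ge0// ltW.
rewrite nneseriesZl; last by move=> k _; rewrite lee_fin mulr_ge0// exprn_ge0// ltW.
by rewrite lte_mul_pinfty ?lee_fin ?expR_ge0// sum_sqr_geometric_lty.
Qed.

(** * The Gamma density at integer times *)

Lemma cvg_exprn_expRN (R : realType) (n : nat) :
  (x ^+ n * expR (- x)) @[x --> +oo%R] --> (0 : R).
Proof.
apply: (@squeeze_cvgr R _ _ R (fun=> 0) (fun x => n.+1`!%:R * x^-1)).
- near=> x; have x0 : 0 < x by near: x; exact: nbhs_pinfty_gt.
  rewrite mulr_ge0 ?expR_ge0 ?exprn_ge0 ?(ltW x0)//= expRN ler_pdivrMr ?expR_gt0//.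
  have := exprn_fact_le_expR n.+1 (ltW x0).
  rewrite ler_pdivrMr// exprSr -ler_pdivlMr// => /le_trans; apply.
  by rewrite [leRHS]mulrC mulrA.
- exact: cvg_cst.
- rewrite -[X in _ --> X](mulr0 n.+1`!%:R); apply: cvgMl_tmp.
  by apply/gtr0_cvgV0; [exact: nbhs_pinfty_gt|exact: cvg_id].
Unshelve. all: by end_near.
Qed.

(** Integration by parts, done on primitives: normalizing them to vanish at
infinity, the primitive of [x ^ n.+1 * exp (- x)] is [n.+1] times the one of
[x ^ n * exp (- x)], minus [x ^ n.+1 * exp (- x)]. *)
Lemma exprn_expRN_primitive (R : realType) (n : nat) :
  exists F : R -> R, [/\ forall x : R, is_derive x 1 F (x ^+ n * expR (- x)),
    F 0 = - n`!%:R & F x @[x --> +oo%R] --> (0 : R)].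
Proof.
have dE (x : R) : is_derive x 1 (fun x => expR (- x)) (- expR (- x)).
  rewrite -mulrN1; apply: (@is_derive1_comp R expR -%R x).
elim: n => [|n [F [dF F0 Fy]]].
  exists (fun x => - expR (- x)); split.
  - by move=> x; apply: is_derive_eq; rewrite expr0 mul1r opprK.
  - by rewrite oppr0 expR0.
  - by rewrite -oppr0; apply: cvgN; exact: cvgr_expR.
exists (fun x => n.+1%:R * F x - x ^+ n.+1 * expR (- x)); split.
- move=> x; have := dF x => ?; have := dE x => ?.
  have d1 : is_derive x 1 (fun x : R => n.+1%:R * F x) (n.+1%:R * (x ^+ n * expR (- x))).
    exact: is_deriveZ.
  have d2 : is_derive x 1 (fun x : R => x ^+ n.+1) (n.+1%:R * x ^+ n).
    have := is_deriveX n.+1 (is_derive_id x (1 : R)); rewrite fctE.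
    by rewrite [_ *: _]mulr1.
  have d3 := is_deriveM d2 (dE x).
  have := is_deriveB d1 d3; congr (is_derive _ _ _ _).
  by rewrite /GRing.scale/=; ring.
- by rewrite F0 expr0n mul0r subr0 factS natrM mulrN.
- rewrite -[X in _ --> X](subrr 0) -[X in _ --> X - _](mulr0 n.+1%:R).
  by apply: cvgB; [exact: cvgMl_tmp|exact: cvg_exprn_expRN].
Qed.

Lemma Gamma_fun_fact (R : realType) (n : nat) : Gamma_fun (n.+1%:R : R) = n`!%:R.
Proof.
have [F [dF F0 Fy]] := exprn_expRN_primitive R n.
have cf : continuous (fun x : R => x ^+ n * expR (- x)).
  move=> x; apply: cvgM; first exact: exprn_continuous.
  by apply: continuous_comp; [exact: cvgN|exact: continuous_expR].
have cF x : {for x, continuous F}.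
  by apply/differentiable_continuous/derivable1_diffP; case: (dF x).
rewrite /Gamma_fun /Rintegral.
have -> : (\int[@lebesgue_measure R]_(x in `]0%R, +oo[) (x `^ (n.+1%:R - 1) * expR (- x))%:E
    = \int[@lebesgue_measure R]_(x in `]0%R, +oo[) (x ^+ n * expR (- x))%:E)%E.
  apply: eq_integral => x; rewrite inE/= in_itv/= andbT => x0.
  by rewrite -natr1 addrK powR_mulrn// ltW.
rewrite integral_itv_obnd_cbnd; last first.
  have mf : measurable_fun setT (fun x : R => x ^+ n * expR (- x)).
    exact: continuous_measurable_fun.
  by apply: measurable_funTS; exact/measurable_EFinP.
have -> : (\int[@lebesgue_measure R]_(x in `[0%R, +oo[) (x ^+ n * expR (- x))%:E
    = 0%:E - (F 0)%:E)%E; last by rewrite F0 -EFinB/= sub0r opprK.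
apply: ge0_continuous_FTC2y => //.
- by move=> x x0; rewrite mulr_ge0 ?exprn_ge0 ?expR_ge0.
- exact: continuous_subspaceT.
- by apply: cvg_at_right_filter; exact: cF.
- by move=> x _; have := dF x => ?; rewrite derive1E derive_val.
Qed.

Lemma gamma_pdf_natE (R : realType) (n : nat) (x : R) :
  gamma_pdf n.+1%:R x = if 0 < x then x ^+ n / n`!%:R * expR (- x) else 0.
Proof.
rewrite /gamma_pdf; case: ifPn => // x0.
by rewrite Gamma_fun_fact -natr1 addrK powR_mulrn// ltW.
Qed.

Lemma measurable_gamma_pdf (R : realType) (t : R) :
  measurable_fun setT (gamma_pdf t).
Proof.
apply: measurable_fun_ifT => //; first exact: measurable_fun_ltr.
apply: measurable_funM.
  by apply: measurable_funM => //; exact: measurable_powR.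
by apply: measurableT_comp => //; exact: measurable_oppr.
Qed.

Lemma integral_exprn_fact (R : realType) (n : nat) (t : R) : 0 < t ->
  (\int[@lebesgue_measure R]_(x in `[0%R, t]) (x ^+ n / n`!%:R)%:E =
   (t ^+ n.+1 / n.+1`!%:R)%:E)%E.
Proof.
move=> t0; pose F (x : R) : R := x ^+ n.+1 / n.+1`!%:R.
have -> : ((t ^+ n.+1 / n.+1`!%:R)%:E = (F t)%:E - (F 0)%:E)%E.
  by rewrite /F expr0n/= mul0r sube0.
have dF (x : R) : is_derive x 1 F (x ^+ n / n`!%:R).
  have := is_deriveX n.+1 (is_derive_id x (1 : R)).
  move=> /(is_deriveZ n.+1`!%:R^-1); rewrite !fctE.
  rewrite (_ : _ *: ((_ * _) *: 1) = x ^+ n / n`!%:R).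
    congr (is_derive x 1 _ _); apply/funext => y.
    by rewrite /F mulrC.
  rewrite /GRing.scale/= mulr1 factS natrM invfM mulrACA mulVf ?pnatr_eq0//.
  by rewrite mul1r mulrC.
have cF : continuous F.
  move=> x; apply/differentiable_continuous/derivable1_diffP; by case: (dF x).
apply: continuous_FTC2 => //.
- apply: continuous_subspaceT => x; apply: cvgM; last exact: cvg_cst.
  exact: exprn_continuous.
- split.
  + by move=> x _; case: (dF x).
  + by apply: cvg_at_right_filter; exact: cF.
  + by apply: cvg_at_left_filter; exact: cF.
- by move=> x _; have := dF x => ?; rewrite derive1E derive_val.
Qed.

Lemma integral_gamma_pdf_le (R : realType) (n : nat) (t : R) : 0 < t ->
  (\int[@lebesgue_measure R]_(x in `]-oo, t]) (gamma_pdf n.+1%:R x)%:E <=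
   (t ^+ n.+1 / n.+1`!%:R)%:E)%E.
Proof.
move=> t0; rewrite -integral_exprn_fact//.
(* The density vanishes at negative points but its polynomial factor may not:
   the comparison is made after extending the factor by zero. *)
have -> : `[0%R, t]%classic = `]-oo, t]%classic `&` `[0%R, +oo[%classic :> set R.
  by apply/seteqP; split => x /=; rewrite !in_itv/= andbT; [case/andP|case=> -> ->].
rewrite integral_mkcondr; apply: ge0_le_integral => //.
- move=> x _; rewrite lee_fin gamma_pdf_natE; case: ifPn => // /ltW x0.
  by rewrite mulr_ge0 ?expR_ge0// divr_ge0// exprn_ge0.
- apply: measurable_funTS; apply/measurable_EFinP; exact: measurable_gamma_pdf.
- apply/(measurable_restrict _ _ _).1 => //.
  by apply: measurable_funTS; apply/measurable_EFinP; exact: measurable_funM.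
- move=> x _; rewrite gamma_pdf_natE patchE; case: ifPn => [x0|_].
    rewrite mem_set; last by rewrite /= in_itv/= ltW.
    rewrite lee_fin ler_piMr//.
      by rewrite divr_ge0// exprn_ge0// ltW.
    by rewrite -expR0 ler_expR oppr_le0 ltW.
  case: ifPn => //; rewrite inE/= in_itv/= andbT => x0.
  by rewrite lee_fin divr_ge0// exprn_ge0.
Qed.

Lemma integral_gamma_pdf_ge (R : realType) (n : nat) (t : R) : 0 < t ->
  ((expR (- t) * (t ^+ n.+1 / n.+1`!%:R))%:E <=
   \int[@lebesgue_measure R]_(x in `]-oo, t]) (gamma_pdf n.+1%:R x)%:E)%E.
Proof.
move=> t0; rewrite EFinM -integral_exprn_fact//.
have mX (D : set R) : measurable_fun D (fun x : R => (x ^+ n / n`!%:R)%:E).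
  by apply: measurable_funTS; apply/measurable_EFinP; exact: measurable_funM.
have mg (D : set R) : measurable_fun D (fun x : R => (gamma_pdf n.+1%:R x)%:E).
  by apply: measurable_funTS; apply/measurable_EFinP; exact: measurable_gamma_pdf.
(* At [0] the density is [0] even for [n = 0]: exclude that point. *)
rewrite -integral_itv_obnd_cbnd//.
rewrite -ge0_integralZl_EFin//; last 2 first.
- move=> x /=; rewrite in_itv/= => /andP[x0 _].
  by rewrite lee_fin divr_ge0// exprn_ge0// ltW.
- exact: mX.
apply: (@le_trans _ _
  (\int[@lebesgue_measure R]_(x in `]0%R, t]) (gamma_pdf n.+1%:R x)%:E)%E).
  apply: ge0_le_integral => //.
  - move=> x /=; rewrite in_itv/= => /andP[x0 _]; rewrite -EFinM lee_fin.
    by rewrite mulr_ge0 ?expR_ge0// divr_ge0// exprn_ge0// ltW.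
  - by apply: measurable_funeM; exact: mX.
  - exact: mg.
  - move=> x /=; rewrite in_itv/= => /andP[x0 xt]; rewrite gamma_pdf_natE x0.
    rewrite -EFinM lee_fin mulrC ler_wpM2l ?ler_expR ?lerN2//.
    by rewrite divr_ge0// exprn_ge0// ltW.
apply: ge0_subset_integral => //; first exact: mg.
- move=> x _; rewrite lee_fin gamma_pdf_natE; case: ifPn => // /ltW x0.
  by rewrite mulr_ge0 ?expR_ge0// divr_ge0// exprn_ge0.
- by move=> x /=; rewrite !in_itv/= => /andP[].
Qed.

Lemma integral_gamma_pdf_le0 (R : realType) (t : R) :
  (\int[@lebesgue_measure R]_(x in `]-oo, 0%R]) (gamma_pdf t x)%:E = 0)%E.
Proof.
apply: integral0_eq => x /=; rewrite in_itv/= => x0.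
by rewrite /gamma_pdf ltNge x0.
Qed.

(** * Paths and marginals of the Gamma process *)

Lemma measurable_inverse {d : measure_display} {T : measurableType d} {R : realType}
    (P : probability T R) (S : R -> {RV P >-> R}) (t : R) :
  cadlag_paths S -> measurable_fun setT (right_continuous_inverse S t).
Proof.
move=> cS; apply: (measurability _ (ErealGenInftyO.measurableE R)).
move=> _ [_ [a ->] <-]; rewrite setTI.
pose A (q : rat) : set T :=
  if (0 <= q) && (ratr q < a) then S (ratr q) @^-1` `]t, +oo[ else set0.
rewrite (_ : _ @^-1` _ = \bigcup_q A q).
  apply: bigcupT_measurable_rat => q; rewrite /A; case: ifPn => // _.
  by rewrite -[X in measurable X]setTI; exact: measurable_funP.
apply/seteqP; split => w /=; rewrite in_itv/=.
  move=> /(gen_inv_lt _ _ (cS w).1)[q [q0 qa tq]]; exists q => //.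
  by rewrite /A q0 qa/= in_itv/= tq.
move=> [q _]; rewrite /A; case: ifPn => // /andP[q0 qa].
rewrite /= in_itv/= andbT => tq.
by apply/(gen_inv_lt _ _ (cS w).1); exists q.
Qed.

Lemma measurable_fine_inverse {d : measure_display} {T : measurableType d} {R : realType}
    (P : probability T R) (S : R -> {RV P >-> R}) (t : R) : cadlag_paths S ->
  measurable_fun setT (fun w => fine (right_continuous_inverse S t w)).
Proof.
move=> cS; apply: (@measurableT_comp _ _ _ _ _ _ fine); last exact: measurable_inverse.
exact: fine_measurable.
Qed.

Lemma gamma_process_le {d : measure_display} {T : measurableType d} {R : realType}
    (P : probability T R) (S : R -> {RV P >-> R}) (t : R) (n : nat) :
  gamma_process S -> 0 < t ->
  (P (S n%:R @^-1` `]-oo, t]) <= (t ^+ n / n`!%:R)%:E)%E.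
Proof.
move=> [_ _ _ _ dS] t0; case: n => [|n].
  rewrite expr0 fact0 divr1 probability_le1//.
  by rewrite -[X in measurable X]setTI; exact: measurable_funP.
have := dS n.+1%:R (ltr0Sn _ _) _ (measurable_itv `]-oo, t]).
by rewrite /distribution/= /pushforward => ->; exact: integral_gamma_pdf_le.
Qed.

Lemma gamma_process_ge {d : measure_display} {T : measurableType d} {R : realType}
    (P : probability T R) (S : R -> {RV P >-> R}) (t : R) (n : nat) :
  gamma_process S -> 0 < t -> (0 < n)%N ->
  ((expR (- t) * (t ^+ n / n`!%:R))%:E <= P (S n%:R @^-1` `]-oo, t]))%E.
Proof.
move=> [_ _ _ _ dS] t0; case: n => // n _.
have := dS n.+1%:R (ltr0Sn _ _) _ (measurable_itv `]-oo, t]).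
by rewrite /distribution/= /pushforward => ->; exact: integral_gamma_pdf_ge.
Qed.

(** By stationarity the increment between two rational times has the law of
some [S h] with [0 < h], whose density vanishes on the nonpositive half-line. *)
Lemma gamma_process_increasing {d : measure_display} {T : measurableType d} {R : realType}
    (P : probability T R) (S : R -> {RV P >-> R}) : gamma_process S ->
  {ae P, forall w : T, forall s t, 0 <= s -> s < t -> S s w < S t w}.
Proof.
move=> [S0 cS _ stS dS].
have aeq (p q : rat) : 0 <= p -> p < q ->
    {ae P, forall w : T, S (ratr p) w < S (ratr q) w}.
  move=> p0 pq; set B := `]-oo, 0%R]%classic : set R.
  have mB : measurable B by exact: measurable_itv.
  have mD : measurable ((S (ratr q) \- S (ratr p)) @^-1` B).
    rewrite -[X in measurable X]setTI; apply: measurable_funB => //; exact: measurable_funP.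
  exists ((S (ratr q) \- S (ratr p)) @^-1` B); split => //.
    have h0 : 0 < ratr q - ratr p :> R by rewrite subr_gt0 ltr_rat.
    have := stS (ratr p) 0 (ratr q - ratr p) _ _ _ B mB.
    have -> : ratr p + (ratr q - ratr p) = ratr q :> R by rewrite addrC subrK.
    move=> -> //; [|by rewrite ler0q|exact: ltW].
    rewrite add0r (_ : _ \- _ = S (ratr q - ratr p) :> (T -> R)); last first.
      by apply/funext => w /=; rewrite S0 subr0.
    have := dS _ h0 _ mB; rewrite /distribution/= /pushforward => ->.
    exact: integral_gamma_pdf_le0.
  move=> w /= /negP; rewrite -leNgt => le.
  by rewrite /B /= in_itv/= subr_le0.
(* Pairs of rationals are enumerated to use countable additivity. *)
have : {ae P, forall w : T, forall n : nat,
    if unpickle n is Some (p, q) then 0 <= (p : rat) -> p < q ->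
      S (ratr p) w < S (ratr q) w else True}.
  apply: ae_foralln => n; case: (unpickle n) => [[p q]|]; last exact: aeW.
  have [p0|p0] := leP 0 p; last by apply: aeW => w.
  have [pq|pq] := ltP p q; last by apply: aeW => w _.
  by apply: filterS (aeq p q p0 pq) => w.
apply: filterS => w inc; apply: increasing_from_rat; first exact: (cS w).1.
by move=> p q; have := inc (pickle (p, q)); rewrite pickleK; apply.
Qed.

(** [P (S_n <= m)] is at most the general term of the exponential series at
[m], which tends to [0]. *)
Lemma gamma_process_unbounded {d : measure_display} {T : measurableType d} {R : realType}
    (P : probability T R) (S : R -> {RV P >-> R}) : gamma_process S ->
  {ae P, forall w : T, forall t : R, exists2 a, 0 <= a & t < S a w}.
Proof.
move=> gS.
have : {ae P, forall w : T, forall m : nat, exists n : nat, m.+1%:R < S n%:R w}.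
  apply: ae_foralln => m; set A := fun n : nat => S n%:R @^-1` `]-oo, (m.+1%:R : R)].
  have mA n : measurable (A n).
    by rewrite -[X in measurable X]setTI; exact: measurable_funP.
  have mI : measurable (\bigcap_n A n) by exact: bigcapT_measurable.
  exists (\bigcap_n A n); split => //.
    have fin : P (\bigcap_n A n) \is a fin_num by exact: fin_num_measure.
    suff : fine (P (\bigcap_n A n)) <= 0 by rewrite -lee_fin fineK// measure_le0 => /eqP.
    apply: (cvgr_to_ge (@cvg_exp_coeff R m.+1%:R)); near=> n; rewrite -lee_fin (fineK fin).
    apply: le_trans (gamma_process_le n gS _); last by rewrite ltr0Sn.
    by apply: le_measure; rewrite ?inE//; [exact: mA|move=> w; exact].
  move=> w /= nex n _; rewrite /A/= in_itv/= leNgt; apply/negP => lt.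
  by apply: nex; exists n.
apply: filterS => w h t.
have [n hn] := h (Num.trunc `|t|); exists n%:R => //.
apply: lt_trans hn; apply: le_lt_trans (ler_norm t) _.
by have /andP[] := truncn_itv (normr_ge0 t).
Unshelve. all: by end_near.
Qed.

(** * Moments of the inverse process *)

Lemma measurable_powR_scale (R : realType) (a : R) :
  measurable_fun setT (fun x : R => x `^ (a * x)).
Proof.
apply: measurable_fun_ifT.
- exact: (measurable_fun_eqr (f := id) (g := cst 0)).
- apply: (measurableT_comp (f := fun b : bool => b%:R : R)) => //.
  apply: (measurable_fun_eqr (f := fun x => a * x) (g := cst 0)) => //.
  exact: measurable_funM.
- apply: measurableT_comp => //; apply: measurable_funM; first exact: measurable_funM.
  exact: measurable_ln.
Qed.

(** Pointwise, [g (R_t)] is at most [C] when [R_t < 1], and otherwise at most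
the [k]-th term of a series of multiples of indicators of [S_k <= t], where
[k + 1] is the integer part of [R_t]. Since [k < R_t], that [S_k <= t] is
the definition of the infimum, so the bound holds on every path. *)
Lemma expectation_inverse_lty {d : measure_display} {T : measurableType d} {R : realType}
    (P : probability T R) (S : R -> {RV P >-> R}) (g : R -> R) (t K C : R) :
    gamma_process S -> 0 < t -> 1 <= K -> t / K * expR 1 < 1 ->
    measurable_fun setT g -> (forall x, 0 <= x -> 0 <= g x) ->
    (forall x, 0 <= x -> g x * K `^ x <= C * x `^ x) ->
  ('E_P[fun w => g (fine (right_continuous_inverse S t w))] < +oo)%E.
Proof.
move=> gS t0 K1 tK mg g0 gC; have cS : cadlag_paths S by case: gS.
have K0 : 0 < K by rewrite (lt_le_trans _ K1).
have C0 : 0 <= C.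
  have := gC 0 (lexx _); rewrite !powRr0 !mulr1; apply: le_trans; exact: g0.
have gle x : 0 <= x -> g x <= C * x `^ x / K `^ x.
  by move=> x0; rewrite ler_pdivlMr ?powR_gt0//; exact: gC.
pose A k := S k%:R @^-1` `]-oo, t].
have mA k : measurable (A k).
  by rewrite -[X in measurable X]setTI; exact: measurable_funP.
pose a k : R := C * (k.+2%:R ^+ k.+2 / K ^+ k).
have a0 k : 0 <= a k by rewrite mulr_ge0// divr_ge0// exprn_ge0// ltW.
have mg' : measurable_fun setT
    (fun w => (g (fine (right_continuous_inverse S t w)))%:E).
  apply/measurable_EFinP; apply: measurableT_comp => //; exact: measurable_fine_inverse.
have Ft0 k w : (0 <= (a k)%:E * (\1_(A k) w)%:E)%E.
  by rewrite -EFinM lee_fin mulr_ge0.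
have mF k : measurable_fun setT (fun w => ((a k)%:E * (\1_(A k) w)%:E)%E).
  by apply: measurable_funeM; apply/measurable_EFinP; exact: measurable_indic.
pose h w := (C%:E + \sum_(k <oo) ((a k)%:E * (\1_(A k) w)%:E))%E.
have mh : measurable_fun setT h.
  by apply: emeasurable_funD => //; apply: ge0_emeasurable_sum.
have gh w : ((g (fine (right_continuous_inverse S t w)))%:E <= h w)%E.
  set r := fine _; have r0 : 0 <= r by rewrite fine_ge0// gen_inv_ge0.
  have [r1|r1] := ltP r 1.
    apply: (@le_trans _ _ C%:E); last by rewrite leeDl// nneseries_ge0.
    rewrite lee_fin (le_trans (gle _ r0))// -mulrA ler_piMr//.
    rewrite ler_pdivrMr ?powR_gt0// mul1r (@le_trans _ _ 1)//.
      have -> : 1 = 1 `^ r :> R by rewrite powR1.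
      by rewrite ge0_ler_powR// ?nnegrE// ltW.
    by rewrite -(powRr0 K) ler_powR.
  (* [fine] sends an infinite inverse to [0], which [1 <= r] excludes. *)
  have rE : right_continuous_inverse S t w = r%:E.
    rewrite /r; case E : (right_continuous_inverse S t w) => [s| |] //.
    - by move: r1; rewrite /r E/= ler10.
    - by move: r1; rewrite /r E/= ler10.
  have := truncn_itv r0; case: (Num.trunc r) => [|k] /andP[kr rk].
    by move: rk; rewrite ltNge r1.
  have Ak : A k w.
    rewrite /A/= in_itv/=; apply: (@gen_inv_gt _ (S ^~ w)) => //.
    rewrite -[gen_inv _ _]/(right_continuous_inverse S t w) rE lte_fin.
    by rewrite (lt_le_trans _ kr)// ltr_nat.
  apply: (@le_trans _ _ (a k)%:E); last first.
    apply: (@le_trans _ _ (\sum_(k <oo) ((a k)%:E * (\1_(A k) w)%:E))%E).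
      apply: le_trans (@nneseries_lim_ge _ _ _ 0 k.+1 _) => //.
      rewrite big_nat_recr//= indicE mem_set// mule1 leeDr// sume_ge0//.
    by rewrite leeDr// lee_fin.
  rewrite lee_fin (le_trans (gle _ r0))// -mulrA ler_wpM2l//.
  apply: ler_pM; rewrite ?powR_ge0 ?invr_ge0 ?powR_ge0//.
    rewrite -powR_mulrn//; apply: le_self_powR => //; exact: ltW.
  rewrite lef_pV2 ?posrE ?powR_gt0 ?exprn_gt0// -powR_mulrn ?(ltW K0)//.
  by rewrite ler_powR// (le_trans _ kr)// ler_nat.
rewrite unlock; apply: (@le_lt_trans _ _ (\int[P]_w h w)%E).
  by apply: ge0_le_integral => // w _; rewrite lee_fin g0// fine_ge0// gen_inv_ge0.
rewrite ge0_integralD//; last 2 first.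
- by move=> w _; apply: nneseries_ge0.
- exact: ge0_emeasurable_sum.
rewrite integral_cst//= probability_setT mule1 lte_add_pinfty ?ltry//.
rewrite integral_nneseries//.
apply: (@le_lt_trans _ _
  (\sum_(k <oo) (C%:E * (k.+2%:R ^+ k.+2 * ((t / K) ^+ k / k`!%:R))%:E))%E).
  apply: lee_nneseries => k _; first by rewrite integral_ge0.
  rewrite ge0_integralZl_EFin//; last first.
    by apply/measurable_EFinP; exact: measurable_indic.
  rewrite integral_indic// setIT.
  apply: (@le_trans _ _ ((a k)%:E * (t ^+ k / k`!%:R)%:E)%E).
    by apply: lee_pmul => //; rewrite ?lee_fin//; exact: gamma_process_le.
  rewrite -!EFinM lee_fin /a expr_div_n le_eqVlt; apply/orP; left; apply/eqP.
  by ring.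
rewrite nneseriesZl; last first.
  by move=> k _; rewrite lee_fin mulr_ge0// divr_ge0// exprn_ge0// mulr_ge0 ?invr_ge0 ?ltW.
rewrite lte_mul_pinfty ?lee_fin//; apply: sum_self_expn_fact_lty => //.
by rewrite divr_gt0.
Qed.

(** Only the largest [n <= N] for which [b n] holds matters: dropping the
indicators below it, the sum is at most [n ^ n] by [sum_self_expn], and
[n ^ n <= r ^ r]. *)
Lemma sum_self_expn_indic_le (R : realType) (r : R) (b : nat -> bool) (N : nat) :
    0 <= r -> (forall n, b n -> n%:R <= r) ->
  \sum_(1 <= n < N.+1) (n%:R ^+ n / 2 * (b n)%:R) <= r `^ r.
Proof.
move=> r0 br; elim: N => [|N IH]; first by rewrite big_geq// powR_ge0.
have [bN|bN] := boolP (b N.+1); last first.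
  by rewrite big_nat_recr//= (negbTE bN) mulr0 addr0.
apply: (@le_trans _ _ (\sum_(1 <= n < N.+2) (n ^ n)%:R / 2)).
  apply: ler_sum => n _; rewrite natrX ler_piMr//.
  by case: (b n).
rewrite -mulr_suml -natr_sum ler_pdivrMr//.
apply: (@le_trans _ _ (2 * N.+1 ^ N.+1)%:R); first by rewrite ler_nat sum_self_expn.
rewrite natrM mulrC ler_wpM2r// natrX -powR_mulrn//.
by apply: le_self_powR; [rewrite ler1n|exact: br].
Qed.

(** Almost surely [S_n <= t] forces [R_t >= n], so [sum_self_expn_indic_le]
bounds [R_t ^ R_t] from below by a combination of the indicators of these events. *)
Lemma expectation_inverse_self_powR_ge {d : measure_display} {T : measurableType d}
    {R : realType} (P : probability T R) (S : R -> {RV P >-> R}) (t : R) :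
    gamma_process S -> (expR 1)^-1 <= t ->
  exists2 c, 0 < c & forall N : nat, ((c * series harmonic N)%:E <=
    'E_P[fun w => (fine (right_continuous_inverse S t w)
      `^ fine (right_continuous_inverse S t w))%R])%E.
Proof.
move=> gS te; have cS : cadlag_paths S by case: gS.
have t0 : 0 < t by rewrite (lt_le_trans _ te)// invr_gt0 expR_gt0.
set r := fun w => fine (right_continuous_inverse S t w).
exists (expR (- t) / (2 * expR 1)).
  by rewrite divr_gt0 ?expR_gt0// mulr_gt0// expR_gt0.
move=> N; pose A k := S k%:R @^-1` `]-oo, t].
have mA k : measurable (A k).
  by rewrite -[X in measurable X]setTI; exact: measurable_funP.
pose a n : R := n%:R ^+ n / 2.
have a0 n : 0 <= a n by rewrite divr_ge0// exprn_ge0.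
have mI n : measurable_fun setT (fun w => (\1_(A n) w)%:E : \bar R).
  by apply/measurable_EFinP; exact: measurable_indic.
have mF n : measurable_fun setT (fun w => ((a n)%:E * (\1_(A n) w)%:E)%E).
  exact: measurable_funeM.
have F0 n w : (0 <= (a n)%:E * (\1_(A n) w)%:E)%E.
  by rewrite -EFinM lee_fin mulr_ge0.
apply: (@le_trans _ _ (\int[P]_w \sum_(1 <= n < N.+1) ((a n)%:E * (\1_(A n) w)%:E))%E).
  rewrite ge0_integral_sum//.
  rewrite /series/= mulr_sumr -sumEFin big_add1/=.
  apply: lee_sum => n _.
  rewrite ge0_integralZl_EFin// integral_indic// setIT.
  apply: (@le_trans _ _ ((a n.+1)%:E * (expR (- t) * (t ^+ n.+1 / n.+1`!%:R))%:E)%E).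
    rewrite -EFinM lee_fin /a.
    have e0 := expR_gt0 (1 : R).
    have f0 : 0 < n.+1`!%:R :> R by rewrite ltr0n fact_gt0.
    have h : (expR 1)^-1 ^+ n.+1 <= t ^+ n.+1.
      by apply: lerXn2r => //; rewrite ?nnegrE ?invr_ge0 ltW.
    have -> : n.+1%:R ^+ n.+1 / 2 * (expR (- t) * (t ^+ n.+1 / n.+1`!%:R)) =
      expR (- t) / 2 * (n.+1%:R ^+ n.+1 / n.+1`!%:R * t ^+ n.+1) by ring.
    have -> : expR (- t) / (2 * expR 1) * harmonic n =
      expR (- t) / 2 * ((expR 1)^-1 * harmonic n) by rewrite invfM; ring.
    rewrite ler_wpM2l ?divr_ge0 ?expR_ge0//.
    have nf0 : 0 <= n.+1%:R ^+ n.+1 / n.+1`!%:R :> R by rewrite divr_ge0 ?exprn_ge0.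
    apply: le_trans (ler_wpM2l nf0 h).
    rewrite /harmonic/= exprVn -expRM_natr mul1r.
    rewrite ler_pdivlMr ?expR_gt0// ler_pdivlMr// -mulrA -invfM mulrC.
    rewrite ler_pdivrMr ?mulr_gt0//.
    have := fact_expR_le R n; rewrite exprSr; lra.
  by rewrite lee_pmul ?lee_fin// ?gamma_process_ge//;
    rewrite mulr_ge0 ?expR_ge0// divr_ge0// exprn_ge0// ltW.
rewrite [in leRHS]unlock; apply: ae_ge0_le_integral => //.
- by move=> w _; apply: sume_ge0.
- exact: emeasurable_sum.
- by move=> w _; rewrite lee_fin powR_ge0.
- apply/measurable_EFinP.
  have mpow : measurable_fun setT (fun x : R => x `^ x).
    by have := @measurable_powR_scale R 1; under eq_fun do rewrite mul1r.
  apply: (measurableT_comp mpow (g := r)); exact: measurable_fine_inverse.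
have := gamma_process_increasing gS; have := gamma_process_unbounded gS.
apply: filterS2 => w un inc _.
under eq_bigr do rewrite -EFinM indicE; rewrite sumEFin lee_fin.
apply: sum_self_expn_indic_le; first by rewrite fine_ge0// gen_inv_ge0.
move=> n; rewrite inE /A/= in_itv/= => Sn.
rewrite -lee_fin fineK; last by have [b b0 bt] := un t; exact: gen_inv_fin_num bt.
exact: (gen_inv_ge inc).
Qed.

Theorem theorem2p2 (R : realType) (d : measure_display) (T : measurableType d)
    (P : probability T R) (S : R -> {RV P >-> R}) (hS : gamma_process S) :
  let Rinv := fun (t : R) (w : T) => fine (right_continuous_inverse S t w) in
  [/\ {ae P, forall w : T,
        (forall t : R, 0 <= t -> right_continuous_inverse S t w \is a fin_num) /\
        {within `[0, +oo[, continuous (fun t : R => Rinv t w)}},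
      (forall theta t : R, theta < 1 -> 0 < t ->
        ('E_P[fun w => (Rinv t w `^ (theta * Rinv t w))%R] < +oo)%E) /\
      (forall theta t : R, 0 < t ->
        ('E_P[fun w => (expR (theta * Rinv t w))%R] < +oo)%E) &
      forall t : R, 0 < t ->
        ('E_P[fun w => (Rinv t w `^ Rinv t w)%R] < +oo)%E <-> t < (expR 1)^-1].
Proof.
have K1 (t : R) : 0 < t -> 1 <= 1 + t * expR 1.
  by move=> t0; rewrite lerDl mulr_ge0 ?expR_ge0// ltW.
have Kt (t : R) : 0 < t -> t / (1 + t * expR 1) * expR 1 < 1.
  move=> t0; have K0 := lt_le_trans ltr01 (K1 t t0).
  by rewrite mulrAC ltr_pdivrMr// mul1r ltrDr.
(* Any [K >= 1] with [e * t < K] serves for the exponents below the critical one;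
   [1 + t * e] is one. *)
move=> Rinv; split.
- have := gamma_process_increasing hS; have := gamma_process_unbounded hS.
  apply: filterS2 => w un inc; split; last exact: gen_inv_continuous.
  by move=> t _; have [a a0 ta] := un t; exact: gen_inv_fin_num ta.
- split=> [theta t theta1 t0|theta t t0]; have K0 := lt_le_trans ltr01 (K1 t t0).
  + have a0 : 0 < 1 - theta by rewrite subr_gt0.
    have [C C0 KC] := powR_le_self_powR a0 K0.
    apply: (@expectation_inverse_lty _ _ _ P S (fun x => x `^ (theta * x))
      t _ C hS t0 (K1 t t0) (Kt t t0)).
    * exact: measurable_powR_scale.
    * by move=> x _; exact: powR_ge0.
    * move=> x; rewrite le_eqVlt => /predU1P[<-|x0].
        by have := KC 0 (lexx _); rewrite !mulr0 !powRr0 !mulr1.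
      have := KC x (ltW x0) => /(ler_wpM2l (powR_ge0 x (theta * x))) /le_trans; apply.
      rewrite mulrCA -powRD; last by rewrite (gt_eqF x0) implybT.
      by rewrite -mulrDl addrC subrK mul1r.
  + have eK0 : 0 < expR theta * (1 + t * expR 1) by rewrite mulr_gt0// expR_gt0.
    (* Here the exponential itself is absorbed, together with [K ^ x]. *)
    have [C C0 KC] := powR_le_self_powR ltr01 eK0.
    apply: (@expectation_inverse_lty _ _ _ P S (fun x => expR (theta * x))
      t _ C hS t0 (K1 t t0) (Kt t t0)).
    * by apply: measurableT_comp => //; exact: measurable_funM.
    * by move=> x _; exact: expR_ge0.
    * move=> x x0; have := KC x x0; rewrite mul1r; apply: le_trans.
      by rewrite powRM ?expR_ge0 ?(ltW K0)// -expRM.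
- move=> t t0; split=> [fin|te].
  + rewrite ltNge; apply/negP => te.
    have [c c0 hc] := expectation_inverse_self_powR_ge hS te.
    apply: (@dvg_harmonic R); apply: nondecreasing_is_cvgn.
      by apply: nondecreasing_series => n _ _; exact: harmonic_ge0.
    exists (fine ('E_P[fun w => (Rinv t w `^ Rinv t w)%R]) / c) => _ [N _ <-].
    rewrite ler_pdivlMr// mulrC -lee_fin fineK ?hc//.
    rewrite ge0_fin_numE//; apply: expectation_ge0 => w; exact: powR_ge0.
  + have h : t / 1 * expR 1 < 1 by rewrite divr1 -ltr_pdivlMr ?expR_gt0// mul1r.
    apply: (@expectation_inverse_lty _ _ _ P S (fun x => x `^ x) t 1 1 hS t0 (lexx _) h).
    * by have := @measurable_powR_scale R 1; under eq_fun do rewrite mul1r.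
    * by move=> x _; exact: powR_ge0.
    * by move=> x _; rewrite powR1 mulr1 mul1r.
Qed.
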